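(* Let $n\ge 1$, $\lambda>0$ and $\sigma_1\ge\dots\ge\sigma_{n-1}\ge 1$, let $\nu$ be the Lorentzian inner product $\operatorname{diag}\{\sigma_1,\sigma_1,\dots,\sigma_{n-1},\sigma_{n-1},1,-1,\lambda\}$ on the Heisenberg Lie algebra $\mathfrak{h}_{2n+1}$ in the basis $\{f_1,g_1,\dots,f_n,g_n,z\}$, and let $\mathscr{B}=\{v_1,\dots,v_{2n+1}\}$ be the orthonormal basis given by $v_{2k-1}=\frac{1}{\sqrt{\sigma_k}}f_k$, $v_{2k}=\frac{1}{\sqrt{\sigma_k}}g_k$ for $1\le k\le n-1$, $v_{2n-1}=f_n$, $v_{2n}=\frac{1}{\sqrt{\lambda}}z$, $v_{2n+1}=g_n$. Then the Ricci operator of $(\mathfrak{h}_{2n+1},\nu)$ is represented in the basis $\mathscr{B}$ by the diagonal matrix $$\operatorname{Ric}=\operatorname{diag}\left\{\frac{-\lambda}{2\sigma_1^2},\frac{-\lambda}{2\sigma_1^2},\frac{-\lambda}{2\sigma_2^2},\frac{-\lambda}{2\sigma_2^2},\dots,\frac{-\lambda}{2\sigma_{n-1}^2},\frac{-\lambda}{2\sigma_{n-1}^2},\frac{\lambda}{2},\theta,\frac{\lambda}{2}\right\},$$ where $\theta=\left(\sum_{k=1}^{n-1}\frac{\lambda}{2\sigma_k^2}\right)-\frac{\lambda}{2}$.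
   Context: The Heisenberg Lie algebra $\mathfrak{h}_{2n+1}$ is the real Lie algebra with basis $\{f_1,g_1,\dots,f_n,g_n,z\}$ whose only nonzero brackets of basis elements (up to antisymmetry) are $[f_i,g_i]=z$, $i=1,\dots,n$. For $n=1$ there are no $\sigma_k$. A Lorentzian inner product is a nondegenerate symmetric bilinear form of signature $(2n,1)$; an orthonormal basis $\{v_1,\dots,v_m\}$ satisfies $\langle v_i,v_j\rangle=0$ for $i\ne j$, $\langle v_i,v_i\rangle=1$ for $i<m$, and $\langle v_m,v_m\rangle=-1$. The Levi-Civita connection of $(\mathfrak{g},\langle\cdot,\cdot\rangle)$ is the bilinear map $(u,v)\mapsto\nabla_uv$ on $\mathfrak{g}$ determined by the Koszul formula $2\langle\nabla_uv,w\rangle=\langle[u,v],w\rangle+\langle[w,u],v\rangle+\langle[w,v],u\rangle$. The curvature is $R_{uv}w=\nabla_{[u,v]}w-\nabla_u\nabla_vw+\nabla_v\nabla_uw$, and the Ricci operator is $\operatorname{Ric}(u)=\sum_{k=1}^{m}\langle v_k,v_k\rangle R_{v_ku}v_k$ for an orthonormal basis $\{v_1,\dots,v_m\}$. *)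

(* Defs.v *)
From HB Require Import structures.
From mathcomp Require Import all_boot all_order all_algebra.
From mathcomp Require Import reals zify ring.

Set Implicit Arguments.
Unset Strict Implicit.
Unset Printing Implicit Defensive.

Import Order.TTheory GRing.Theory Num.Theory.
Local Open Scope ring_scope.

Section LorentzianGeometry.
Variables (R : realType) (V : vectType R).
Implicit Types (br nabla : {bilinear V -> V -> V}) (u v w : V).

(* In each orthonormal basis the last vector is the timelike one. *)
Definition lorentz_orthonormal_basis (ip : V -> V -> R) m (e : 'I_m.+1 -> V) :=
  basis_of fullv (codom e) /\
  forall i j, ip (e i) (e j) =
    if i == j then (if i == ord_max then -1 else 1) else 0.

Definition levi_civita (br : V -> V -> V) (ip : V -> V -> R)
    (nabla : V -> V -> V) :=
  forall u v w, 2 * ip (nabla u v) w =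
    ip (br u v) w + ip (br w u) v + ip (br w v) u.

Definition curvature (br nabla : V -> V -> V) u v w :=
  nabla (br u v) w - nabla u (nabla v w) + nabla v (nabla u w).

Definition ricci (br nabla : V -> V -> V) (ip : V -> V -> R) m
    (e : 'I_m -> V) u :=
  \sum_k ip (e k) (e k) *: curvature br nabla (e k) u (e k).

Lemma ricci_linear br nabla ip m (e : 'I_m -> V) :
  linear (ricci br nabla ip e).
Proof.
move=> a u v; rewrite /ricci scaler_sumr -big_split; apply: eq_bigr => k _ /=.
rewrite scalerA mulrC -scalerA -scalerDr; congr (_ *: _); rewrite /curvature.
rewrite !(linearPl, linearPr) /= !scalerDr scalerN opprD.
by rewrite [RHS]addrACA [X in _ = X + _]addrACA.
Qed.

HB.instance Definition _ br nabla ip m (e : 'I_m -> V) :=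
  GRing.isLinear.Build R V V *:%R (ricci br nabla ip e)
    (ricci_linear br nabla ip e).

(* Column [j] of the matrix holds the coordinates of [f (e j)] in [e]. *)
Definition represented_in (f : {linear V -> V}) m (e : 'I_m -> V) (A : 'M[R]_m) :=
  forall j, f (e j) = \sum_i A i j *: e i.

Section Existence.
Variables (br : {bilinear V -> V -> V}) (ip : {symmetric V}).
Variables (m : nat) (e : 'I_m.+1 -> V).
Hypothesis e_onb : lorentz_orthonormal_basis ip e.

Lemma lorentz_coord w : w = \sum_i (ip (e i) (e i) * ip (e i) w) *: e i.
Proof.
case: e_onb => /andP[/eqP e_span _] e_orth.
have: w \in <<codom e>>%VS by rewrite e_span memvf.
rewrite span_def big_image => /memv_sumP[c c_in ->].
have {}c_in i : exists a, c i = a *: e i by apply/vlineP/c_in.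
apply: eq_bigr => i _; rewrite linear_sumr (bigD1 i) //= big1 => [|j /negPf ji].
  have [a ->] := c_in i.
  rewrite addr0 linearZr_LR /= e_orth eqxx.
  by case: ifP => _; rewrite ?mulr1 ?mul1r // mulrN1 mulN1r opprK.
by have [a ->] := c_in j; rewrite linearZr_LR /= e_orth eq_sym ji mulr0.
Qed.

Let koszul u v w := ip (br u v) w + ip (br w u) v + ip (br w v) u.
Let conn u v := \sum_i (ip (e i) (e i) * (koszul u v (e i) / 2)) *: e i.

Let conn_bilinear :
  bilinear_for (GRing.Scale.Law.clone _ _ *:%R _)
               (GRing.Scale.Law.clone _ _ *:%R _) conn.
Proof.
by split=> [v | u] a x y; rewrite /= /conn scaler_sumr -big_split;
  apply: eq_bigr => i _ /=; rewrite scalerA -scalerDl; congr (_ *: _);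
  rewrite /koszul !(linearPl, linearPr) /=; field.
Qed.

Lemma levi_civita_exists :
  exists nabla : {bilinear V -> V -> V}, levi_civita br ip nabla.
Proof.
pose b := bilinear_isBilinear.Build R V V V _ _ conn conn_bilinear.
pose nabla : {bilinear V -> V -> V} := HB.pack conn b.
exists nabla => u v w; rewrite -!/(koszul u v w) /= /conn.
rewrite {2}[w]lorentz_coord linear_sumlz mulr_sumr.
have -> : koszul u v (\sum_i (ip (e i) (e i) * ip (e i) w) *: e i) =
          \sum_i (ip (e i) (e i) * ip (e i) w) * koszul u v (e i).
  rewrite /koszul !(linear_sumr, linear_sumlz) -!big_split /=.
  by apply: eq_bigr => i _; rewrite !(linearZr_LR, linearZl_LR) /= !mulrDr.
apply: eq_bigr => i _; rewrite linearZl_LR /=.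
by field.
Qed.

Lemma levi_civita_unique (nabla nabla' : V -> V -> V) :
    levi_civita br ip nabla -> levi_civita br ip nabla' ->
  forall u v, nabla u v = nabla' u v.
Proof.
move=> h h' u v; rewrite [LHS]lorentz_coord [RHS]lorentz_coord.
apply: eq_bigr => i _; congr (_ * _ *: _); apply: (@mulfI _ 2%:R).
  by rewrite pnatr_eq0.
have sym x y : ip x y = ip y x by rewrite [LHS]hermC expr0 mul1r.
by rewrite ![ip (e i) _]sym h h'.
Qed.

End Existence.

End LorentzianGeometry.

Notation heisenberg R n := 'rV[R]_(2 * n).+1.

Section Heisenberg.
Variables (R : realType) (n : nat).
Implicit Types (x y : heisenberg R n) (i j k : nat).

(* The coordinates are relative to the ordered basis f_1, g_1, ..., f_n, g_n, z,
   with [heis_f] and [heis_g] meaningful for the indices 1, ..., n only. *)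
Definition heis_f k : heisenberg R n := 'e_(inord (2 * k.-1)).
Definition heis_g k : heisenberg R n := 'e_(inord (2 * k.-1).+1).
Definition heis_z : heisenberg R n := 'e_ord_max.

Definition heis_bracket x y : heisenberg R n :=
  (\sum_(1 <= k < n.+1)
     (x 0 (inord (2 * k.-1)) * y 0 (inord (2 * k.-1).+1)
      - x 0 (inord (2 * k.-1).+1) * y 0 (inord (2 * k.-1)))) *: heis_z.

Lemma heis_bracket_bilinear :
  bilinear_for (GRing.Scale.Law.clone _ _ *:%R _)
               (GRing.Scale.Law.clone _ _ *:%R _) heis_bracket.
Proof.
by split=> [y | x] a u v; rewrite /= /heis_bracket scalerA -scalerDl;
  congr (_ *: _); rewrite mulr_sumr -big_split; apply: eq_bigr => k _;
  rewrite /= !mxE; ring.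
Qed.

HB.instance Definition _ := bilinear_isBilinear.Build R
  (heisenberg R n) (heisenberg R n) (heisenberg R n) _ _
  heis_bracket heis_bracket_bilinear.

Lemma heis_bracket_alternating x : heis_bracket x x = 0.
Proof.
rewrite /heis_bracket big1 ?scale0r // => k _; ring.
Qed.

Lemma heis_bracketC x y : heis_bracket x y = - heis_bracket y x.
Proof.
rewrite /heis_bracket -scaleNr -sumrN; congr (_ *: _).
by apply: eq_bigr => k _; ring.
Qed.

Lemma heis_bracketz x : heis_bracket x heis_z = 0.
Proof.
rewrite /heis_bracket big_nat big1 ?scale0r // => k /andP[k1 kn].
rewrite !mxE /= -!val_eqE /= !inordK; try lia.
by rewrite !ltn_eqF ?mulr0 ?subrr //; lia.
Qed.

Lemma heis_bracket_jacobi x y w :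
  heis_bracket x (heis_bracket y w) + heis_bracket y (heis_bracket w x)
    + heis_bracket w (heis_bracket x y) = 0.
Proof.
have nil2 u v t : heis_bracket u (heis_bracket v t) = 0.
  by rewrite {2}/heis_bracket linearZr_LR /= heis_bracketz scaler0.
by rewrite !nil2 !addr0.
Qed.

Lemma heis_bracketE i j : (1 <= i <= n)%N -> (1 <= j <= n)%N ->
  [/\ heis_bracket (heis_f i) (heis_g j) = (i == j)%:R *: heis_z,
      heis_bracket (heis_f i) (heis_f j) = 0 &
      heis_bracket (heis_g i) (heis_g j) = 0].
Proof.
move=> i_n j_n.
have coordE a b : (a <= 2 * n)%N -> (b <= 2 * n)%N ->
    ('e_(inord a) : heisenberg R n) 0 (inord b) = (b == a)%:R.
  by move=> an bn; rewrite mxE eqxx -val_eqE /= !inordK.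
have inE k : (1 <= k < n.+1)%N -> [/\ (2 * k.-1 <= 2 * n)%N,
  ((2 * k.-1).+1 <= 2 * n)%N, (2 * i.-1 <= 2 * n)%N,
  ((2 * i.-1).+1 <= 2 * n)%N & (2 * j.-1 <= 2 * n)%N /\
  ((2 * j.-1).+1 <= 2 * n)%N].
  by move=> kn; do !split; lia.
split; rewrite /heis_bracket /heis_f /heis_g.
- congr (_ *: _).
  rewrite (bigD1_seq i) ?mem_index_iota ?iota_uniq //= big_nat_cond big1 => [|k].
    have [] := inE i i_n => ? ? ? ? [? ?]; rewrite !coordE // eqxx addr0.
    have -> : ((2 * i.-1).+1 == (2 * j.-1).+1) = (i == j) by lia.
    have -> : ((2 * i.-1).+1 == 2 * i.-1)%N = false by lia.
    by rewrite mul1r mul0r subr0.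
  case/andP=> kn ki; have [] := inE k kn => ? ? ? ? [? ?]; rewrite !coordE //.
  have -> : (2 * k.-1 == 2 * i.-1)%N = false by lia.
  have -> : ((2 * k.-1).+1 == 2 * i.-1)%N = false by lia.
  by rewrite !mul0r subr0.
- rewrite big_nat big1 ?scale0r // => k kn.
  have [] := inE k kn => ? ? ? ? [? ?]; rewrite !coordE //.
  have -> : ((2 * k.-1).+1 == 2 * i.-1)%N = false by lia.
  have -> : ((2 * k.-1).+1 == 2 * j.-1)%N = false by lia.
  by rewrite mulr0 mul0r subr0.
- rewrite big_nat big1 ?scale0r // => k kn.
  have [] := inE k kn => ? ? ? ? [? ?]; rewrite !coordE //.
  have -> : (2 * k.-1 == (2 * i.-1).+1)%N = false by lia.
  have -> : (2 * k.-1 == (2 * j.-1).+1)%N = false by lia.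
  by rewrite mulr0 mul0r subr0.
Qed.

(* The inner product diag{d_0, d_1, ...} in the above basis. *)
Definition heis_form (d : seq R) : heisenberg R n -> heisenberg R n -> R :=
  form_of_matrix idfun (diag_mx (\row_j d`_j)).

Lemma heis_form_delta d (a b : 'I_(2 * n).+1) :
  heis_form d 'e_a 'e_b = d`_a *+ (a == b).
Proof. by rewrite /heis_form rV_formee !mxE. Qed.

HB.instance Definition _ d := Bilinear.copy (heis_form d)
  (form_of_matrix idfun (diag_mx (\row_j d`_j))).

Lemma heis_form_sym d x y : heis_form d x y = (-1) ^+ false * idfun (heis_form d y x).
Proof.
rewrite mul1r /= /heis_form /form_of_matrix !map_mx_id // -[LHS]mxtrace_tr.
by rewrite !trmx_mul trmxK tr_diag_mx mulmxA.
Qed.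

HB.instance Definition _ d := isHermitianSesquilinear.Build _ _ _ _
  (heis_form d) (heis_form_sym d).

Definition sigma_form (lambda : R) (sigma : nat -> R) :=
  heis_form
    (flatten [seq [:: sigma k; sigma k] | k <- index_iota 1 n]
     ++ [:: 1; -1; lambda]).

Definition sigma_basis (lambda : R) (sigma : nat -> R) :
    'I_(2 * n).+1 -> heisenberg R n :=
  fun i : 'I_(2 * n).+1 =>
    (flatten [seq [:: (Num.sqrt (sigma k))^-1 *: heis_f k;
                      (Num.sqrt (sigma k))^-1 *: heis_g k]
              | k <- index_iota 1 n]
     ++ [:: heis_f n; (Num.sqrt lambda)^-1 *: heis_z; heis_g n])`_i.

Section SigmaBasis.
Variables (lambda : R) (sigma : nat -> R).
Hypotheses (n_ge1 : (1 <= n)%N) (lambda_gt0 : 0 < lambda).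
Hypothesis sigma_ge1 : forall k, (1 <= k < n)%N -> 1 <= sigma k.

Let nth_pairs T (x0 : T) (a b : nat -> T) m l t i :
  nth x0 (flatten [seq [:: a k; b k] | k <- iota m l] ++ t) i =
  if (i < 2 * l)%N then if odd i then b (m + i./2)%N else a (m + i./2)%N
  else nth x0 t (i - 2 * l).
Proof.
elim: l m i => [|l IHl] m i /=; first by rewrite subn0.
case: i => [|[|i]] /=; rewrite ?addn0 ?mulnS //.
rewrite IHl negbK !addSnnS; have -> : (i.+2 < 2 + 2 * l)%N = (i < 2 * l)%N by lia.
by have -> : (i.+2 - (2 + 2 * l) = i - 2 * l)%N by lia.
Qed.

Let d := (flatten [seq [:: sigma k; sigma k] | k <- index_iota 1 n]
     ++ [:: 1; -1; lambda]).

(* The position, among f_1, g_1, ..., f_n, g_n, z, of the vector of which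
   [sigma_basis i] is a multiple. *)
Let pos i := if i == (2 * n).-1 then (2 * n)%N
  else if i == (2 * n)%N then (2 * n).-1 else i.

Let sigma_basisE (i : 'I_(2 * n).+1) :
  exists2 c : R, sigma_basis lambda sigma i = c *: 'e_(inord (pos i)) &
    c ^+ 2 * d`_(pos i) = if i == ord_max then -1 else 1.
Proof.
have sqrtV (a : R) : 0 < a -> (Num.sqrt a)^-1 ^+ 2 * a = 1.
  by move=> a_gt0; rewrite exprVn sqr_sqrtr ?ltW // mulVf ?gt_eqF.
have ni := ltn_ord i.
rewrite /sigma_basis /d /index_iota !nth_pairs -val_eqE /= /pos.
case: ifP => [i_lt | i_ge].
  have -> : (nat_of_ord i == (2 * n).-1) = false by lia.
  have -> : (nat_of_ord i == (2 * n)%N) = false by lia.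
  rewrite i_lt; exists (Num.sqrt (sigma (1 + i./2)%N))^-1.
    have := odd_double_half i; rewrite add1n -mul2n /heis_f /heis_g /=.
    by case: ifP => _ /= iE; congr (_ *: 'e_(inord _)); lia.
  rewrite if_same sqrtV //; apply: lt_le_trans ltr01 (sigma_ge1 _).
  have := odd_double_half i; lia.
have [iE|[iE|iE]] : nat_of_ord i = (2 * n).-2 \/
    nat_of_ord i = (2 * n).-1 \/ nat_of_ord i = (2 * n)%N by lia.
- rewrite iE; exists 1.
    have -> : ((2 * n).-2 - 2 * (n - 1) = 0)%N by lia.
    have -> : ((2 * n).-2 == (2 * n).-1) = false by lia.
    have -> : ((2 * n).-2 == 2 * n)%N = false by lia.
    by rewrite scale1r /= /heis_f; congr ('e_(inord _)); lia.
  have -> : ((2 * n).-2 == (2 * n).-1) = false by lia.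
  have -> : ((2 * n).-2 == 2 * n)%N = false by lia.
  have -> : ((2 * n).-2 < 2 * (n - 1))%N = false by lia.
  have -> : ((2 * n).-2 - 2 * (n - 1) = 0)%N by lia.
  by rewrite expr1n mul1r.
- rewrite iE eqxx; exists (Num.sqrt lambda)^-1.
    have -> : ((2 * n).-1 - 2 * (n - 1) = 1)%N by lia.
    by congr (_ *: 'e_ _); apply/val_inj; rewrite /= inordK.
  have -> : (2 * n < 2 * (n - 1))%N = false by lia.
  have -> : (2 * n - 2 * (n - 1) = 2)%N by lia.
  have -> : ((2 * n).-1 == 2 * n)%N = false by lia.
  exact: sqrtV.
- rewrite iE eqxx; exists 1.
    have -> : (2 * n - 2 * (n - 1) = 2)%N by lia.
    have -> : (2 * n == (2 * n).-1)%N = false by lia.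
    by rewrite scale1r /= /heis_g; congr ('e_(inord _)); lia.
  have -> : (2 * n == (2 * n).-1)%N = false by lia.
  have -> : ((2 * n).-1 < 2 * (n - 1))%N = false by lia.
  have -> : ((2 * n).-1 - 2 * (n - 1) = 1)%N by lia.
  by rewrite expr1n mul1r.
Qed.

Let pos_lt (k : 'I_(2 * n).+1) : (pos k < (2 * n).+1)%N.
Proof. by have := ltn_ord k; rewrite /pos; do 2?case: ifP => ?; lia. Qed.

Let pos_inj (i j : 'I_(2 * n).+1) :
  (inord (pos i) == inord (pos j) :> 'I_(2 * n).+1) = (i == j).
Proof.
have := ltn_ord i; have := ltn_ord j; rewrite -!val_eqE /= !inordK //.
by rewrite /pos => ? ?; do 4?case: ifP => ?; lia.
Qed.

Lemma sigma_basis_orthonormal :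
  lorentz_orthonormal_basis (sigma_form lambda sigma) (sigma_basis lambda sigma).
Proof.
have orth (i j : 'I_(2 * n).+1) : sigma_form lambda sigma (sigma_basis lambda sigma i)
    (sigma_basis lambda sigma j) =
    if i == j then (if i == ord_max then -1 else 1) else 0.
  have [c Bi c2] := sigma_basisE i; rewrite Bi; case: eqVneq => [<- | /negPf ij].
    rewrite Bi.
    rewrite /sigma_form linearZl_LR linearZr_LR /= heis_form_delta eqxx inordK //.
    by rewrite mulrA -expr2.
  have [c' -> _] := sigma_basisE j; rewrite /sigma_form linearZl_LR linearZr_LR /=.
  by rewrite heis_form_delta pos_inj ij !mulr0.
split=> //; set B := sigma_basis lambda sigma in orth *.
rewrite basisEfree size_map -cardE card_ord dimvf dim_matrix subvf.
rewrite [X in (X <= _)%N](mul1n _) leqnn !andbT.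
have -> : codom B = [tuple B i | i < (2 * n).+1] by [].
apply/freeP => a; under eq_bigr => j _ do rewrite -tnth_nth tnth_mktuple.
move=> a0 i; have /eqP : sigma_form lambda sigma (B i) 0 = 0.
  by rewrite /sigma_form linear0r.
rewrite -a0 /sigma_form linear_sumr (bigD1 i) //= big1 => [|j /negPf ji].
  rewrite addr0 linearZr_LR /= -/(sigma_form _ _) orth eqxx mulf_eq0.
  by case: ifP; rewrite ?oppr_eq0 oner_eq0 orbF => _ /eqP.
by rewrite linearZr_LR /= -/(sigma_form _ _) orth eq_sym ji mulr0.
Qed.

End SigmaBasis.

End Heisenberg.

(* Main.v *)
Require Import Defs.
From HB Require Import structures.
From mathcomp Require Import all_boot all_order all_algebra.
From mathcomp Require Import reals zify ring.

Set Implicit Arguments.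
Unset Strict Implicit.
Unset Printing Implicit Defensive.

Import Order.TTheory GRing.Theory Num.Theory.
Local Open Scope ring_scope.

(** The Koszul formula turns bracket and connection into one skew operator.
    Let z be the central vector and put J u := - 2 nabla_u z.  All brackets are
    multiples of z, so the formula gives <J u, v> = <[u, v], z>: J encodes the
    bracket ([bracket_jmap]), J is skew, J z = 0, and nabla is an explicit
    combination of z and J ([nabla_jmap]).  Substituting this in
    R_{x u} x and contracting over an orthonormal basis yields ([ricci_jmap])
<<
      Ric u = J (J u) / (2 <z,z>) + <z,u> / (4 <z,z>^2) * T z,
      T = sum_k <e_k,e_k> <J e_k, J e_k>.
>>
    The only place where the contracting basis survives is T, and T does not
    depend on it ([contract_square_norm]), so it may be evaluated in the given
    basis even though Ric is taken in an arbitrary one.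

    For a diagonal form on the Heisenberg algebra, J preserves each plane
    spanned by f_k and g_k: with p = <f_k,f_k>, q = <g_k,g_k> one has
    J f_k = (lambda/q) g_k and J g_k = -(lambda/p) f_k.  Hence J^2 is the scalar
    - lambda^2/(pq) on that plane, and the Ricci eigenvalue is
    - lambda/(2pq) ([heis_ricci_fg]).  This is -lambda/(2 sigma_k^2) when
    p = q = sigma_k, and lambda/2 on the Lorentzian plane, where p = 1 and
    q = -1.  Each plane contributes 2 lambda^2/(pq) to T, so that
    T = 4 lambda theta and Ric z = theta z. *)

(** * Contractions over a Lorentzian orthonormal basis *)

Section OrthonormalContraction.
Variables (R : realType) (V : vectType R) (ip : {symmetric V}).

Lemma symmetric_formC u v : ip u v = ip v u.
Proof. by rewrite [LHS]hermC expr0 mul1r. Qed.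

Variables (m : nat) (e : 'I_m.+1 -> V).
Hypothesis e_onb : lorentz_orthonormal_basis ip e.

(** The sign <e_k,e_k> compensates the timelike vector in the expansion of [w];
    this is what makes signed contractions basis-free. *)
Lemma contract_linear (W : lmodType R) (g : {linear V -> W}) w :
  \sum_k (ip (e k) (e k) * ip (e k) w) *: g (e k) = g w.
Proof.
rewrite [in RHS](lorentz_coord e_onb w) linear_sum.
by apply: eq_bigr => k _; rewrite linearZ.
Qed.

Lemma orthonormal_parseval v w :
  \sum_k ip (e k) (e k) * (ip (e k) v * ip (e k) w) = ip v w.
Proof.
rewrite [in RHS](lorentz_coord e_onb w) linear_sumr; apply: eq_bigr => k _.
by rewrite linearZr_LR /= (symmetric_formC v) mulrCA mulrA [RHS]mulrC mulrA.
Qed.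

Lemma orthonormal_nondegenerate u v : (forall w, ip u w = ip v w) -> u = v.
Proof.
move=> uv; rewrite (lorentz_coord e_onb u) [RHS](lorentz_coord e_onb v).
by apply: eq_bigr => k _; rewrite (symmetric_formC _ u) uv (symmetric_formC v).
Qed.

End OrthonormalContraction.

(** This is the trace of the adjoint of [g] composed with [g]: expanding one
    factor in each basis gives the same double sum. *)
Lemma contract_square_norm (R : realType) (V : vectType R) (ip : {symmetric V})
    m (e : 'I_m.+1 -> V) m' (b : 'I_m'.+1 -> V) (g : {linear V -> V}) :
    lorentz_orthonormal_basis ip e -> lorentz_orthonormal_basis ip b ->
  \sum_k ip (e k) (e k) * ip (g (e k)) (g (e k))
  = \sum_k ip (b k) (b k) * ip (g (b k)) (g (b k)).
Proof.
move=> e_onb b_onb.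
have gE k : ip (g (e k)) (g (e k))
    = \sum_i ip (b i) (b i) * ip (b i) (e k) * ip (g (b i)) (g (e k)).
  rewrite -[X in ip X](contract_linear b_onb g) linear_sumlz.
  by apply: eq_bigr => i _; rewrite linearZl_LR.
under eq_bigr => k _ do rewrite gE mulr_sumr.
rewrite exchange_big; apply: eq_bigr => i _ /=.
rewrite -[X in _ = _ * ip _ X](contract_linear e_onb g) linear_sumr mulr_sumr.
apply: eq_bigr => k _; rewrite linearZr_LR /= [ip (e k) (b i)]symmetric_formC.
by ring.
Qed.

(** * The operator J of a central vector *)

(** Kaplan's skew operator of a two-step nilpotent metric Lie algebra, taken
    from the connection so that it is linear by construction.  It is locked so
    that linearity rewriting does not expand it to [nabla]. *)
HB.lock Definition jmap (R : realType) (V : vectType R)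
  (nabla : {bilinear V -> V -> V}) (z u : V) : V := -2 *: nabla u z.

Section Jmap.
Variables (R : realType) (V : vectType R) (nabla : {bilinear V -> V -> V}) (z : V).

Lemma jmap_linear : linear (jmap nabla z).
Proof.
move=> a u v; rewrite jmap.unlock linearPl scalerDr !scalerA; congr (_ *: _ + _).
by rewrite mulrC.
Qed.

HB.instance Definition _ := GRing.isLinear.Build R V V *:%R (jmap nabla z) jmap_linear.
End Jmap.

(** * Curvature when the brackets fill a non-null central line *)

Section CentralLine.
Variables (R : realType) (V : vectType R).
Variables (br nabla : {bilinear V -> V -> V}) (ip : {symmetric V}).
Variables (m : nat) (e : 'I_m.+1 -> V) (z : V).
Hypothesis e_onb : lorentz_orthonormal_basis ip e.
Hypothesis br_alt : forall u, br u u = 0.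
Hypothesis br_line : forall u v, br u v \in <[z]>%VS.
Hypothesis br_central : forall u, br u z = 0.
Hypothesis z_nonnull : ip z z != 0.
Hypothesis nabla_lc : levi_civita br ip nabla.

Local Notation lambda := (ip z z).
Local Notation J := (jmap nabla z).

Let brC u v : br u v = - br v u.
Proof.
have := br_alt (u + v); rewrite !(linearDl, linearDr) /= !br_alt add0r addr0.
by move/eqP; rewrite addr_eq0 => /eqP.
Qed.

Let two_neq0 : 2 != 0 :> R. Proof. by rewrite pnatr_eq0. Qed.

(** Koszul's formula for <nabla_u z, w> keeps a single bracket, because the
    other two involve the central vector. *)
Lemma ip_jmap u w : ip (J u) w = ip (br u w) z.
Proof.
rewrite jmap.unlock linearZl_LR /= mulNr (nabla_lc u z w) !br_central linear0l.
by rewrite brC linearNl /= linear0l; ring.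
Qed.

Lemma bracket_jmap u v : br u v = (ip (J u) v / lambda) *: z.
Proof.
rewrite ip_jmap; have /vlineP[c ->] := br_line u v.
by rewrite linearZl_LR /= mulfK.
Qed.

Lemma jmap_skew u v : ip (J u) v = - ip u (J v).
Proof.
by rewrite [ip u _]symmetric_formC !ip_jmap brC linearNl.
Qed.

Lemma jmap_center : J z = 0.
Proof.
apply: (orthonormal_nondegenerate e_onb) => w.
by rewrite ip_jmap brC br_central oppr0 linear0l linear0l.
Qed.

(** Both sides have the same product with every vector: in the Koszul formula
    each bracket is a multiple of [z] with coefficient given by J. *)
Lemma nabla_jmap u v : nabla u v =
  2^-1 *: ((ip (J u) v / lambda) *: z
           - (ip z v / lambda) *: J u - (ip z u / lambda) *: J v).
Proof.
apply: (orthonormal_nondegenerate e_onb) => w; apply: (mulfI two_neq0).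
rewrite nabla_lc !bracket_jmap !(linearZl_LR, linearBl) /=.
rewrite ![ip (J w) _]jmap_skew ![ip w _]symmetric_formC.
by field; rewrite z_nonnull.
Qed.

Let ip_z_jmap u : ip z (J u) = 0.
Proof. by apply/eqP; rewrite -oppr_eq0 -jmap_skew jmap_center linear0l. Qed.

(** The terms are grouped by how they contract over [x]: against [J u],
    against [z], and as the square norm of [J x]. *)
Lemma curvature_jmap u x : curvature br nabla x u x =
    (3 / (4 * lambda) * ip x (J u)) *: J x
  + ip x z *: (- (ip (J x) (J u) / (4 * lambda ^+ 2)) *: z
               - (ip z x / (4 * lambda ^+ 2)) *: J (J u)
               + (ip z u / (4 * lambda ^+ 2)) *: J (J x))
  + (ip z u / (4 * lambda ^+ 2) * ip (J x) (J x)) *: z.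
Proof.
(* Pairing with an arbitrary vector makes the identity one between scalars. *)
apply: (orthonormal_nondegenerate e_onb) => w.
have nabla_z v : nabla z v = - 2^-1 *: J v.
  rewrite nabla_jmap jmap_center linear0l mul0r scale0r scaler0 subrr sub0r.
  by rewrite divff // scale1r scalerN scaleNr.
(* [JB] and [ipB] expand the inner connection terms, which have this shape
   by [nabla_jmap]. *)
have JB v w' c d a : J (2^-1 *: (a *: z - c *: v - d *: w')) =
    - (c / 2) *: J v - (d / 2) *: J w'.
  rewrite linearZ linearB linearB /= !linearZ /= jmap_center scaler0 add0r.
  by rewrite scalerDr !scalerN !scalerA scaleNr ![2^-1 * _]mulrC.
have ipB y v w' c d a : ip y (2^-1 *: (a *: z - c *: v - d *: w')) =
    2^-1 * (a * ip y z - c * ip y v - d * ip y w').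
  by rewrite !(linearZr_LR, linearBr).
rewrite /curvature bracket_jmap linearZl_LR /= nabla_z.
rewrite !(nabla_jmap _ (nabla _ _)) !(nabla_jmap _ x) !JB !ipB.
rewrite !(linearDl, linearBl, linearNl, linearZl_LR) /=.
rewrite !ip_z_jmap ![ip (J _) z]symmetric_formC !ip_z_jmap.
have -> : ip (J x) x = 0 by rewrite ip_jmap br_alt linear0l.
rewrite [ip x (J u)]symmetric_formC [ip (J u) x]jmap_skew [ip u (J x)]symmetric_formC.
rewrite [ip x z]symmetric_formC [ip (J u) (J x)]symmetric_formC.
by field; rewrite z_nonnull.
Qed.

(** The coefficient of [J (J u)] is 3/(4 <z,z>) from the J u contraction minus
    1/(4 <z,z>) from the square of <x,z>.  The other contractions against [z]
    vanish because J z = 0. *)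
Theorem ricci_jmap u : ricci br nabla ip e u =
    (2 * lambda)^-1 *: J (J u)
  + (ip z u / (4 * lambda ^+ 2)
     * \sum_k ip (e k) (e k) * ip (J (e k)) (J (e k))) *: z.
Proof.
have ip_JJ v : ip (J v) (J u) = - ip v (J (J u)) by rewrite jmap_skew.
rewrite /ricci.
under eq_bigr => k _ do rewrite curvature_jmap ip_JJ [ip z (e k)]symmetric_formC.
pose eps k := ip (e k) (e k).
transitivity (
    (3 / (4 * lambda)) *: (\sum_k (eps k * ip (e k) (J u)) *: J (e k))
  + ((\sum_k eps k * (ip (e k) z * ip (e k) (J (J u)))) / (4 * lambda ^+ 2)) *: z
  - ((\sum_k eps k * (ip (e k) z * ip (e k) z)) / (4 * lambda ^+ 2)) *: J (J u)
  + (ip z u / (4 * lambda ^+ 2)) *: J (\sum_k (eps k * ip (e k) z) *: J (e k))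
  + (ip z u / (4 * lambda ^+ 2) * \sum_k eps k * ip (J (e k)) (J (e k))) *: z).
  rewrite [J (\sum_k _)]linear_sum !scaler_sumr !mulr_suml !scaler_suml -sumrN mulr_sumr.
  rewrite scaler_suml -!big_split; apply: eq_bigr => k _ /=.
  rewrite [J (_ *: J _)]linearZ_LR !scalerDr !scalerN !scalerA !addrA -!scaleNr /=.
  by congr (_ *: _ + _ *: _ + _ *: _ + _ *: _ + _ *: _); rewrite /eps; try ring.
rewrite !orthonormal_parseval // !(contract_linear e_onb J).
rewrite /= jmap_center linear0 ip_z_jmap mul0r scale0r scaler0.
by rewrite !addr0 -scalerBl; congr (_ *: _ + _); field.
Qed.
End CentralLine.

(** * Diagonal forms on the Heisenberg algebra *)

Section HeisenbergRicci.
Variables (R : realType) (n : nat) (d : seq R).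
Local Notation H := (heisenberg R n).
Local Notation ip := (@heis_form R n d).
Local Notation z := (heis_z R n).
Local Notation lambda := d`_(2 * n).
Implicit Types (w : H) (k : nat).

Lemma heis_form_el (a : 'I_(2 * n).+1) w : ip 'e_a w = d`_a * w 0 a.
Proof.
rewrite {1}[w]row_sum_delta linear_sumr (bigD1 a) //= big1 => [|j /negPf ja].
  by rewrite linearZr_LR /= heis_form_delta eqxx mulr1n addr0 mulrC.
by rewrite linearZr_LR /= heis_form_delta eq_sym ja mulr0.
Qed.

Lemma heis_bracket_f k w : (1 <= k <= n)%N ->
  heis_bracket (heis_f R n k) w = w 0 (inord (2 * k.-1).+1) *: z.
Proof.
move=> kn; rewrite /heis_bracket /heis_f; congr (_ *: _).
rewrite (bigD1_seq k) ?mem_index_iota ?iota_uniq //= big_nat_cond big1 => [|i].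
  rewrite !mxE -!val_eqE /= !inordK ?eqxx ?mul1r ?addr0; try lia.
  by rewrite (_ : (_ == _) = false) ?mul0r ?subr0 //; lia.
case/andP=> i_n ik; rewrite !mxE -!val_eqE /= !inordK; try lia.
have -> : (2 * i.-1 == 2 * k.-1)%N = false by lia.
have -> : ((2 * i.-1).+1 == 2 * k.-1)%N = false by lia.
by rewrite !mul0r subr0.
Qed.

Lemma heis_bracket_g k w : (1 <= k <= n)%N ->
  heis_bracket (heis_g R n k) w = - w 0 (inord (2 * k.-1)) *: z.
Proof.
move=> kn; rewrite /heis_bracket /heis_g; congr (_ *: _).
rewrite (bigD1_seq k) ?mem_index_iota ?iota_uniq //= big_nat_cond big1 => [|i].
  rewrite !mxE -!val_eqE /= !inordK ?eqxx ?mul1r ?addr0; try lia.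
  by rewrite (_ : (_ == _) = false) ?mul0r ?sub0r //; lia.
case/andP=> i_n ik; rewrite !mxE -!val_eqE /= !inordK; try lia.
have -> : (2 * i.-1 == (2 * k.-1).+1)%N = false by lia.
have -> : ((2 * i.-1).+1 == (2 * k.-1).+1)%N = false by lia.
by rewrite !mul0r subr0.
Qed.

Variables (nabla : {bilinear H -> H -> H}) (m : nat) (e : 'I_m.+1 -> H).
Hypothesis lambda_neq0 : lambda != 0.
Hypothesis nabla_lc : levi_civita (@heis_bracket R n) ip nabla.
Hypothesis e_onb : lorentz_orthonormal_basis ip e.
Local Notation J := (jmap nabla z).

Lemma heis_form_zz : ip z z = lambda.
Proof. by rewrite heis_form_delta eqxx. Qed.

Let z_nonnull : ip z z != 0. Proof. by rewrite heis_form_zz. Qed.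

Lemma heis_bracket_line x y : heis_bracket x y \in <[z]>%VS.
Proof. exact/memvZ/memv_line. Qed.

Lemma heis_jmap_z : J z = 0.
Proof.
exact: (jmap_center e_onb (@heis_bracket_alternating R n)
  (@heis_bracketz R n) nabla_lc).
Qed.

Let heis_ip_jmap u w : ip (J u) w = ip (heis_bracket u w) z.
Proof.
exact: (ip_jmap (@heis_bracket_alternating R n) (@heis_bracketz R n) nabla_lc).
Qed.

Let heis_nondegenerate u v : (forall w, ip u w = ip v w) -> u = v.
Proof. exact: (orthonormal_nondegenerate e_onb). Qed.

(** The sum is over a basis [b] that may differ from the basis [e] which
    defines the Ricci operator. *)
Lemma heis_ricci_jmap m' (b : 'I_m'.+1 -> H) u : lorentz_orthonormal_basis ip b ->
  ricci (@heis_bracket R n) nabla ip e u = (2 * lambda)^-1 *: J (J u)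
  + (ip z u / (4 * lambda ^+ 2)
     * \sum_i ip (b i) (b i) * ip (J (b i)) (J (b i))) *: z.
Proof.
move=> b_onb; rewrite -heis_form_zz.
rewrite -(contract_square_norm J e_onb b_onb).
exact: (ricci_jmap e_onb (@heis_bracket_alternating R n) heis_bracket_line
  (@heis_bracketz R n) z_nonnull nabla_lc).
Qed.

Section Plane.
Variables (k : nat) (p q : R).
Hypotheses (k_n : (1 <= k <= n)%N) (p_neq0 : p != 0) (q_neq0 : q != 0).
Hypotheses (dp : d`_(2 * k.-1) = p) (dq : d`_(2 * k.-1).+1 = q).
Local Notation f := (heis_f R n k).
Local Notation g := (heis_g R n k).

Lemma heis_jmap_f : J f = (lambda / q) *: g.
Proof.
apply: heis_nondegenerate => w.
rewrite heis_ip_jmap heis_bracket_f // !linearZl_LR /= heis_form_zz heis_form_el.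
rewrite inordK ?dq; last lia.
by field.
Qed.

Lemma heis_jmap_g : J g = (- lambda / p) *: f.
Proof.
apply: heis_nondegenerate => w.
rewrite heis_ip_jmap heis_bracket_g // !linearZl_LR /= heis_form_zz heis_form_el.
rewrite inordK ?dp; last lia.
by field.
Qed.

Lemma heis_ricci_fg (a : R) u : u = f \/ u = g ->
  ricci (@heis_bracket R n) nabla ip e (a *: u) =
    (- lambda / (2 * (p * q))) *: (a *: u).
Proof.
move=> uE.
have JJ : J (J u) = (- lambda ^+ 2 / (p * q)) *: u.
  case: uE => ->.
    rewrite heis_jmap_f linearZ /= heis_jmap_g scalerA; congr (_ *: _).
    by field; rewrite p_neq0 q_neq0.
  rewrite heis_jmap_g linearZ /= heis_jmap_f scalerA; congr (_ *: _).
  by field; rewrite p_neq0 q_neq0.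
have zu : ip z u = 0.
  by case: uE => ->; rewrite heis_form_delta -val_eqE /= inordK ?gtn_eqF //; lia.
rewrite linearZ /= (heis_ricci_jmap _ e_onb) zu !mul0r scale0r addr0.
rewrite JJ !scalerA; congr (_ *: _).
by field; rewrite p_neq0 q_neq0.
Qed.

(** The summand of T at a rescaled [f] or [g]; at unit length a^4 is 1/p^2 or
    1/q^2, so both give lambda^2/(pq). *)
Lemma heis_jmap_norm_f (a : R) :
  ip (a *: f) (a *: f) * ip (J (a *: f)) (J (a *: f)) = a ^+ 4 * lambda ^+ 2 * p / q.
Proof.
rewrite linearZ /= heis_jmap_f !linearZl_LR !linearZr_LR /= !heis_form_delta !eqxx.
by rewrite !inordK ?dp ?dq ?mulr1n; try lia; field.
Qed.

Lemma heis_jmap_norm_g (a : R) :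
  ip (a *: g) (a *: g) * ip (J (a *: g)) (J (a *: g)) = a ^+ 4 * lambda ^+ 2 * q / p.
Proof.
rewrite linearZ /= heis_jmap_g !linearZl_LR !linearZr_LR /= !heis_form_delta !eqxx.
by rewrite !inordK ?dp ?dq ?mulr1n; try lia; field.
Qed.
End Plane.
End HeisenbergRicci.

(** * Lists made of consecutive pairs *)

Section PairLists.
Variables (I T : Type).
Implicit Types (a b : I -> T) (s : seq I) (t : seq T).

Lemma size_flatten_pairs a b s :
  size (flatten [seq [:: a k; b k] | k <- s]) = (2 * size s)%N.
Proof. by elim: s => //= k s ->; rewrite mulnS. Qed.

Lemma nth_flatten_pairs x0 k0 a b s t i : (i < size s)%N ->
  nth x0 (flatten [seq [:: a k; b k] | k <- s] ++ t) (2 * i) = a (nth k0 s i) /\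
  nth x0 (flatten [seq [:: a k; b k] | k <- s] ++ t) (2 * i).+1 = b (nth k0 s i).
Proof. by elim: s i => [|k s IHs] [|i] // i_lt; rewrite mulnS; apply: IHs. Qed.

Lemma nth_flatten_pairs_cat x0 a b s t i :
  nth x0 (flatten [seq [:: a k; b k] | k <- s] ++ t) (2 * size s + i) = nth x0 t i.
Proof. by rewrite nth_cat size_flatten_pairs ltnNge leq_addr /= addKn. Qed.
End PairLists.

(** The basis and the matrix diagonal are lists of this shape, so comparing
    them pair by pair avoids splitting positions by parity. *)
Lemma all2_flatten_pairs (I : eqType) (S T : Type) (r : S -> T -> bool)
    (a b : I -> S) (c d : I -> T) (s : seq I) u v :
    {in s, forall k, r (a k) (c k) && r (b k) (d k)} -> all2 r u v ->
  all2 r (flatten [seq [:: a k; b k] | k <- s] ++ u)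
         (flatten [seq [:: c k; d k] | k <- s] ++ v).
Proof.
move=> + uv; elim: s => //= k s IHs rs.
have /andP[-> ->] := rs k (mem_head k s); apply: IHs => i i_s.
by apply: rs; rewrite inE i_s orbT.
Qed.

Lemma all2_nth (S T : Type) (r : S -> T -> bool) x0 y0 s t i :
  all2 r s t -> (i < size s)%N -> r (nth x0 s i) (nth y0 t i).
Proof.
rewrite all2E => /andP[/eqP st /(all_nthP (x0, y0)) rst] i_s.
by have := rst i; rewrite size_zip -st minnn nth_zip //=; apply.
Qed.

(** * The Ricci operator of the form with entries sigma and 1, -1, lambda *)

Theorem theorem3p8 (R : realType) (n : nat) (lambda : R) (sigma : nat -> R)
    (n_ge1 : (1 <= n)%N)
    (lambda_gt0 : 0 < lambda)
    (sigma_noninc : forall j k : nat,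
      (1 <= j)%N -> (j <= k)%N -> (k < n)%N -> sigma k <= sigma j)
    (sigma_ge1 : forall k : nat, (1 <= k < n)%N -> 1 <= sigma k)
    (nabla : {bilinear heisenberg R n -> heisenberg R n -> heisenberg R n})
    (nabla_lc :
      levi_civita (@heis_bracket R n) (sigma_form lambda sigma) nabla)
    (e : 'I_(2 * n).+1 -> heisenberg R n)
    (e_onb : lorentz_orthonormal_basis (sigma_form lambda sigma) e) :
  let theta := (\sum_(1 <= k < n) lambda / (2 * sigma k ^+ 2)) - lambda / 2 in
  represented_in
    (ricci (@heis_bracket R n) nabla (sigma_form lambda sigma) e)
    (@sigma_basis R n lambda sigma)
    (diag_mx (\row_j
      (flatten [seq [:: - lambda / (2 * sigma k ^+ 2);
                        - lambda / (2 * sigma k ^+ 2)]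
                | k <- index_iota 1 n]
       ++ [:: lambda / 2; theta; lambda / 2])`_j)).
Proof.
move=> theta; rewrite /sigma_form in nabla_lc e_onb *.
have b_onb := sigma_basis_orthonormal n_ge1 lambda_gt0 sigma_ge1.
rewrite /sigma_form in b_onb.
set d := _ ++ _ in nabla_lc e_onb b_onb *.
have sigma_gt0 k : (1 <= k < n)%N -> 0 < sigma k.
  by move=> /sigma_ge1; apply: lt_le_trans.
have szE : size (index_iota 1 n) = n.-1 by rewrite size_iota subn1.
(* The pairs with k < n fill the first 2(n-1) positions of [d]; those of f_n,
   g_n and z follow. *)
have d_last i : d`_(2 * n.-1 + i) = [:: 1; -1; lambda]`_i.
  by rewrite /d -szE nth_flatten_pairs_cat.
have d_n : d`_(2 * n.-1) = 1 by rewrite -[(2 * _)%N]addn0 d_last.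
have d_n1 : d`_(2 * n.-1).+1 = -1 by rewrite -addn1 d_last.
have d_z : d`_(2 * n) = lambda.
  by rewrite (_ : (2 * n = 2 * n.-1 + 2)%N) ?d_last //; lia.
have d_k k : (1 <= k < n)%N -> d`_(2 * k.-1) = sigma k /\ d`_(2 * k.-1).+1 = sigma k.
  move=> kn; rewrite /d.
  have [|-> ->] := @nth_flatten_pairs _ _ 0 0 sigma sigma (index_iota 1 n)
    [:: 1; -1; lambda] k.-1.
    by rewrite szE; lia.
  by rewrite nth_iota; [split; congr sigma; lia | lia].
have neq1 : -1 != 0 :> R by rewrite oppr_eq0 oner_eq0.
have lambda_neq0 : d`_(2 * n) != 0 by rewrite d_z gt_eqF.
(* The matrix being diagonal, it suffices that each basis vector is an
   eigenvector for the matching entry. *)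
pose r v a := ricci (@heis_bracket R n) nabla (heis_form d) e v == a *: v.
have nn : (1 <= n <= n)%N by rewrite n_ge1 leqnn.
have kn_le k : (1 <= k < n)%N -> (1 <= k <= n)%N by lia.
pose f := heis_f R n; pose g := heis_g R n; pose c k := (Num.sqrt (sigma k))^-1.
have c2 k : (1 <= k < n)%N -> c k ^+ 2 * sigma k = 1.
  by move=> /sigma_gt0 s0; rewrite exprVn sqr_sqrtr ?ltW // mulVf ?gt_eqF.
pose S := flatten [seq [:: c k *: f k; c k *: g k] | k <- index_iota 1 n]
  ++ [:: f n; (Num.sqrt lambda)^-1 *: heis_z R n; g n].
have size_S : size S = (2 * n).+1.
  by rewrite size_cat size_flatten_pairs szE /=; lia.
have ricE u := heis_ricci_jmap lambda_neq0 nabla_lc e_onb u b_onb.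
pose J := jmap nabla (heis_z R n).
(* T is a sum over the list [S] of basis vectors, so it splits over the planes;
   z contributes nothing because J z = 0. *)
have trE : \sum_i heis_form d (sigma_basis lambda sigma i) (sigma_basis lambda sigma i)
    * heis_form d (J (sigma_basis lambda sigma i)) (J (sigma_basis lambda sigma i))
    = 4 * lambda * theta.
  pose G v := heis_form d v v * heis_form d (J v) (J v).
  transitivity (\sum_(v <- S) G v); first by rewrite [RHS](big_nth 0) size_S big_mkord.
  rewrite big_cat big_flatten big_map !big_cons big_nil /= addr0.
  have G_k k : (1 <= k < n)%N -> G (c k *: f k) + G (c k *: g k)
      = 2 * (lambda ^+ 2 / sigma k ^+ 2).
    move=> kn; have [dp dq] := d_k k kn; have sk := sigma_gt0 k kn.
    have s_neq0 : sigma k != 0 by rewrite gt_eqF.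
    have k_n := kn_le k kn.
    rewrite /G (heis_jmap_norm_f lambda_neq0 nabla_lc e_onb k_n s_neq0 s_neq0 dp dq).
    rewrite (heis_jmap_norm_g lambda_neq0 nabla_lc e_onb k_n s_neq0 s_neq0 dp dq).
    rewrite d_z; have -> : c k ^+ 4 = (sigma k ^+ 2)^-1.
      apply: (mulIf (expf_neq0 2 s_neq0)); rewrite mulVf ?expf_neq0 //.
      by rewrite -(expr1n _ 2) -(c2 k kn) exprMn -exprM.
    by field.
  have Gf : G (f n) = - lambda ^+ 2.
    rewrite /G -[f n]scale1r.
    rewrite (heis_jmap_norm_f lambda_neq0 nabla_lc e_onb nn (oner_neq0 _) neq1 d_n d_n1).
    by rewrite d_z; field.
  have Gg : G (g n) = - lambda ^+ 2.
    rewrite /G -[g n]scale1r.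
    rewrite (heis_jmap_norm_g lambda_neq0 nabla_lc e_onb nn (oner_neq0 _) neq1 d_n d_n1).
    by rewrite d_z; field.
  have Gz a : G (a *: heis_z R n) = 0.
    by rewrite /G /J linearZ /= (heis_jmap_z nabla_lc e_onb) scaler0 linear0l mulr0.
  rewrite Gf Gg Gz add0r /theta.
  rewrite big_seq (eq_bigr (fun k => 4 * lambda * (lambda / (2 * sigma k ^+ 2)))).
    by rewrite -big_seq -!mulr_sumr; field.
  move=> k; rewrite mem_index_iota => kn; rewrite !big_cons big_nil addr0 G_k //.
  by field; rewrite gt_eqF // sigma_gt0.
pose A := flatten [seq [:: - lambda / (2 * sigma k ^+ 2); - lambda / (2 * sigma k ^+ 2)]
    | k <- index_iota 1 n] ++ [:: lambda / 2; theta; lambda / 2].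
have eigen : all2 r S A.
  apply: all2_flatten_pairs => [k|].
    rewrite mem_index_iota => kn; have [dp dq] := d_k k kn.
    have s_neq0 : sigma k != 0 by rewrite gt_eqF // sigma_gt0.
    have rE := heis_ricci_fg lambda_neq0 nabla_lc e_onb (kn_le k kn)
      s_neq0 s_neq0 dp dq (c k).
    by rewrite /r !rE; auto; rewrite d_z -expr2 !eqxx.
  have rE := heis_ricci_fg lambda_neq0 nabla_lc e_onb nn (oner_neq0 _) neq1 d_n d_n1 1.
  have half : - d`_(2 * n) / (2 * (1 * -1)) = lambda / 2 by rewrite d_z; field.
  rewrite /= /r -[f n]scale1r -[g n]scale1r !rE; auto.
  rewrite half !eqxx linearZ /= ricE trE (heis_jmap_z nabla_lc e_onb) linear0 scaler0.
  rewrite add0r heis_form_zz d_z !scalerA !andbT; apply/eqP; congr (_ *: _).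
  by field; rewrite sqrtr_eq0 -ltNge lambda_gt0 gt_eqF.
move=> j; rewrite (bigD1 j) //= big1 => [|i /negPf ij]; last first.
  by rewrite !mxE ij mulr0n scale0r.
rewrite !mxE eqxx mulr1n addr0; apply/eqP.
by apply: (all2_nth 0 0 eigen); rewrite size_S.
Qed.
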